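(* Let $D\ge 0$ be an integer and let $M$ be an $m\times n$ binary $D$-disjunct matrix with $n\ge D+1$. Then the binary linear code $\mathcal{C}(M)$ with parity-check matrix $M$ has minimum distance $d_{\min}(\mathcal{C}(M))\ge D+2$.
   Context: A binary matrix $M$ is $D$-disjunct if, for any $D+1$ (distinct) columns of $M$ with one column designated, there is a row with a $1$ in the designated column and a $0$ in each of the other $D$ columns. For an $m\times n$ binary matrix $M$, $\mathcal{C}(M)=\{\mathbf{x}\in\mathbb{F}_2^n : M\mathbf{x}^T=\mathbf{0}\}$. The minimum distance $d_{\min}$ of a linear code is the minimum Hamming weight (number of nonzero coordinates) of a nonzero codeword, taken to be $\infty$ if the only codeword is $\mathbf{0}$. *)

(* Defs.v *)
From mathcomp Require Import all_boot all_order all_algebra.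
From mathcomp Require Import constructive_ereal.

Set Implicit Arguments.
Unset Strict Implicit.
Unset Printing Implicit Defensive.

Import Order.TTheory GRing.Theory Num.Theory.
Local Open Scope ring_scope.

(* Columns are identified with their indices: "distinct columns" means distinct
   positions, which may a priori hold equal vectors. [S] is the family of D+1
   columns and [j0] the designated one. *)
Definition disjunct (D m n : nat) (M : 'M['F_2]_(m, n)) : Prop :=
  forall (S : {set 'I_n}) (j0 : 'I_n), #|S| = D.+1 -> j0 \in S ->
  exists i : 'I_m,
    M i j0 = 1 /\ (forall j : 'I_n, j \in S -> j != j0 -> M i j = 0).

Definition parity_check_code (m n : nat) (M : 'M['F_2]_(m, n)) : {set 'rV['F_2]_n} :=
  [set x : 'rV['F_2]_n | M *m x^T == 0].

Definition hamming_weight (n : nat) (x : 'rV['F_2]_n) : nat :=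
  #|[set j : 'I_n | x 0 j != 0]|.

(* Valued in the extended integers, so that the minimum over an empty set of
   nonzero codewords is +oo. *)
Definition min_distance (n : nat) (C : {set 'rV['F_2]_n}) : \bar int :=
  \big[Order.min/+oo%E]_(x in C | x != 0) ((hamming_weight x)%:Z)%:E.

(* Main.v *)
(* Complete the support of a nonzero codeword of weight at most D+1 to a set S
   of D+1 columns and designate a column j0 of the support. The row provided by
   disjunctness meets S, hence the support, only in j0, so that its parity check
   reads x_(j0) = 0, a contradiction. *)
Require Import Defs.
From mathcomp Require Import all_boot all_order all_algebra.
From mathcomp Require Import constructive_ereal.

Set Implicit Arguments.
Unset Strict Implicit.
Unset Printing Implicit Defensive.

Import Order.TTheory GRing.Theory Num.Theory.
Local Open Scope ring_scope.

(** Induction on [k]: unless [A] already has the required size, add one point outside the set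
    obtained for the previous size. *)
Lemma superset_of_card (T : finType) (A : {set T}) (k : nat) :
  (#|A| <= k <= #|T|)%N -> exists2 S : {set T}, A \subset S & #|S| = k.
Proof.
elim: k => [|k IHk] /andP[leAk lekT].
  by exists A => //; apply/eqP; rewrite -leqn0.
move: leAk; rewrite leq_eqVlt => /predU1P[<-|ltAk]; first by exists A.
have [|S sAS cardS] := IHk; first by rewrite -ltnS ltAk ltnW.
have /set0Pn[y] : ~: S != set0 by rewrite -card_gt0 cardsCs setCK cardS subn_gt0.
rewrite inE => yNS; exists (y |: S); last by rewrite cardsU1 yNS cardS.
exact: subset_trans sAS (subsetUr _ _).
Qed.

Lemma disjunct_hamming_weight (D m n : nat) (M : 'M['F_2]_(m, n))
    (x : 'rV['F_2]_n) :
  disjunct D M -> (D < n)%N -> x \in parity_check_code M -> x != 0 ->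
  (D.+1 < hamming_weight x)%N.
Proof.
move=> disjM ltDn; rewrite inE => /eqP Mx0 /rV0Pn[j0 xj0].
rewrite ltnNge; apply/negP => wx.
have [|S suppS cardS] := @superset_of_card _ [set j | x 0 j != 0] D.+1.
  by rewrite wx card_ord.
have j0S : j0 \in S by rewrite (subsetP suppS) // inE.
have [i [Mij0 Mi0]] := disjM S j0 cardS j0S.
move/matrixP/(_ i 0): Mx0; rewrite !mxE (bigD1 j0) //= big1 => [|j jj0].
  by rewrite Mij0 mxE mul1r addr0; apply/eqP.
(* For [j != j0], the matrix entry vanishes when [j] is in [S]; otherwise [x 0 j] does, since [S]
   contains the support. *)
rewrite mxE; have [jS|jNS] := boolP (j \in S); first by rewrite Mi0 ?mul0r.
have /negP := contra (subsetP suppS j) jNS.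
by rewrite inE => /negP/negbNE/eqP ->; rewrite mulr0.
Qed.

Theorem proposition2p1 (D m n : nat) (M : 'M['F_2]_(m, n))
    (hM : disjunct D M) (hn : (D + 1 <= n)%N) :
  (((D + 2)%N%:Z)%:E <= min_distance (parity_check_code M))%E.
Proof.
(* The bound is also checked on the default [+oo], the minimum when the code is zero. *)
apply: le_bigmin => [|x /andP[xC x0]]; first exact: leey.
rewrite lee_fin lez_nat addn2.
by apply: (disjunct_hamming_weight hM) => //; rewrite addn1 in hn.
Qed.
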